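(* Let $n\geq 1$ be an integer, let $f\in\mathcal{A}_n$, let $\alpha$ be a real number, and let $\beta$ be a complex number with $\mathrm{Re}(\beta)<n$. Suppose that either (i) $0<\alpha\leq\frac12$ and $\left|zf''(z)-\beta\left(f'(z)-1\right)\right|<\alpha|n-\beta|$ for all $z\in\mathbb{U}$, or (ii) $\frac12\leq\alpha<1$ and $\left|zf''(z)-\beta\left(f'(z)-1\right)\right|<(1-\alpha)|n-\beta|$ for all $z\in\mathbb{U}$. Then $$\left|\frac{1}{f'(z)}-\frac{1}{2\alpha}\right|<\frac{1}{2\alpha}\qquad\text{for all } z\in\mathbb{U},$$ which implies that $f\in\mathcal{C}(\alpha)$.
   Context: $\mathbb{U}=\{z\in\mathbb{C}:|z|<1\}$ is the open unit disk. For an integer $n\geq1$, $\mathcal{A}_n$ is the class of functions $f$ analytic in $\mathbb{U}$ with power series of the form $f(z)=z+a_{n+1}z^{n+1}+a_{n+2}z^{n+2}+\cdots$. For $0\leq\alpha<1$, $\mathcal{C}(\alpha)$ is the class of $f\in\mathcal{A}_n$ such that $\mathrm{Re}(f'(z))>\alpha$ for all $z\in\mathbb{U}$. Inequalities involving a quotient include the assertion that the quotient is defined, i.e. here that $f'(z)\neq0$ for $z\in\mathbb{U}$. *)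

(* Defs.v *)
From Stdlib Require Import Reals.
From Coquelicot Require Import Coquelicot.

Open Scope R_scope.

Definition unit_disk (z : C) : Prop := Cmod z < 1.

(* Complex differentiability at every point of the open set [D].  The module
   structure is given explicitly: on the carrier [C], [ex_derive] could also be
   elaborated with real scalars. *)
Definition analytic_on (D : C -> Prop) (f : C -> C) : Prop :=
  forall z : C, D z -> @ex_derive C_AbsRing C_NormedModule f z.

(* f(z) = z + a_{n+1} z^{n+1} + a_{n+2} z^{n+2} + ... on the open unit disk.
   Values of [f] outside the disk are irrelevant. *)
Definition class_A (n : nat) (f : C -> C) : Prop :=
  analytic_on unit_disk f /\
  exists a : nat -> C,
    a 0%nat = RtoC 0 /\ a 1%nat = RtoC 1 /\
    (forall k : nat, (1 < k <= n)%nat -> a k = RtoC 0) /\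
    forall z : C, unit_disk z -> @is_pseries C_AbsRing C_NormedModule a z (f z).

(* Used for 0 <= alpha < 1.  [C_derive] is a total function; it is the complex
   derivative wherever that exists ([C_derive_correct]), hence on the disk. *)
Definition class_C (n : nat) (alpha : R) (f : C -> C) : Prop :=
  class_A n f /\ forall z : C, unit_disk z -> alpha < Re (C_derive f z).

(* Main.v *)
Require Import Defs.
From Stdlib Require Import Reals Lra Lia ClassicalEpsilon.
From Coquelicot Require Import Coquelicot.

(** Put p = f' - 1.  It vanishes to order n at 0, so p = z^n P, and with
    c = n - beta the hypothesis bounds z p' - beta p = z^n Q, where
    Q = z P' + c P, by M |c|; here M is alpha or 1 - alpha.  The theorem
    follows from |P| <= M: then |f' - 1| <= M |z|^n < M, so Re f' > 1 - M >= alpha,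
    and 1/w lies in the disk with centre and radius 1/(2 alpha) as soon as
    Re w > alpha ([half_plane_inversion]).

    The bound on P takes two steps.

    - |z^n Q| <= M |c| gives |Q| <= M |c|, a Schwarz lemma of order n
      ([schwarz_order]), which rests on the maximum principle
      ([max_modulus_annulus]).
    - |z P' + c P| <= M |c| with Re c > 0 gives |P| <= M ([first_order_bound]).
      Moving z to w = z (1 - d/c), which does not increase the modulus because
      Re c > 0, one has (1 + d) P(z) = P(w) + d Q(z)/c + O(d^2).  If m is the
      supremum of |P| on |z| <= r, this reads (1 + d) m <= m + d M + O(d^2),
      and m <= M on letting d tend to 0.  This replaces the usual appeal to
      Jack's lemma at a point where |P| is maximal.

    The maximum principle is discrete too: the average of a function over the
    four points z + i^j h cancels the first two Taylor terms, so |Q| + e |z|^2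
    is, up to O(h^3), at most its mean over these points minus e h^2, and cannot
    come near its supremum away from the boundary.

    Both arguments use only a second-order Taylor expansion whose remainder is
    cubic uniformly on smaller disks.  For power series, [expands_taylor] derives
    it from the algebraic expansion of (z + h)^k ([pow_taylor]) and also yields
    termwise differentiation. *)

Open Scope R_scope.

(** * Power series on the unit disk *)

Definition expands (a : nat -> C) (F : C -> C) : Prop :=
  forall z : C, unit_disk z ->
    @is_series C_AbsRing C_NormedModule (fun k => a k * z ^ k)%C (F z).

Lemma pow_n_Cpow (z : C) (k : nat) : @pow_n C_Ring z k = (z ^ k)%C.
Proof. induction k as [|k IH]; simpl; [reflexivity | now rewrite IH]. Qed.

Lemma expands_pseries (a : nat -> C) (F : C -> C) :
  (forall z, unit_disk z -> @is_pseries C_AbsRing C_NormedModule a z (F z)) ->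
  expands a F.
Proof.
  intros H z Hz. generalize (H z Hz). apply is_series_ext. intro k.
  change (Cmult (@pow_n C_Ring z k) (a k) = a k * z ^ k)%C.
  rewrite pow_n_Cpow. ring.
Qed.

Lemma expands_ext (a b : nat -> C) (F G : C -> C) :
  (forall k, a k = b k) -> (forall z, unit_disk z -> F z = G z) ->
  expands a F -> expands b G.
Proof.
  intros Hab HFG H z Hz. rewrite <- (HFG z Hz). generalize (H z Hz).
  apply is_series_ext. intro k. now rewrite Hab.
Qed.

Lemma Cmod_series_le (u : nat -> C) (l : C) (v : nat -> R) :
  @is_series C_AbsRing C_NormedModule u l ->
  (forall k, Cmod (u k) <= v k) -> ex_series v -> Cmod l <= Series v.
Proof.
  intros Hu Huv Hv.
  assert (Hlim : is_lim_seq (fun n => Cmod (@sum_n C_AbelianMonoid u n)) (Cmod l)).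
  { apply (filterlim_comp _ _ _ _ _ _ _ _ Hu
      (@filterlim_norm C_AbsRing C_NormedModule l)). }
  refine (is_lim_seq_le _ _ (Cmod l) (Series v) _ Hlim (Series_correct v Hv)).
  induction n as [|n IH].
  - rewrite !sum_O. apply Huv.
  - rewrite !sum_Sn. eapply Rle_trans; [apply Cmod_triangle |].
    apply Rplus_le_compat; [exact IH | apply Huv].
Qed.

Lemma series_terms_bounded (u : nat -> C) (l : C) :
  @is_series C_AbsRing C_NormedModule u l -> exists B, forall k, Cmod (u k) <= B.
Proof.
  intro Hu.
  destruct (@filterlim_bounded C_AbsRing C_NormedModule (sum_n u)) as [M HM].
  { exists l. exact Hu. }
  exists (M + M). intros [|k].
  - generalize (HM 0%nat). rewrite sum_O. change (Cmod (u 0%nat) <= M -> Cmod (u 0%nat) <= M + M).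
    intro H. generalize (Cmod_ge_0 (u 0%nat)). lra.
  - replace (u (S k)) with (sum_n (G := C_AbelianMonoid) u (S k) + - sum_n (G := C_AbelianMonoid) u k)%C.
    + eapply Rle_trans; [apply Cmod_triangle |]. rewrite Cmod_opp.
      apply Rplus_le_compat; apply HM.
    + rewrite sum_Sn. change (sum_n (G := C_AbelianMonoid) u k + u (S k) + - sum_n (G := C_AbelianMonoid) u k = u (S k))%C. ring.
Qed.

(** Convergence at one point of larger modulus bounds the terms there, and
    geometric decay makes up the difference. *)
Lemma expands_abs (a : nat -> C) (F : C -> C) (r : R) :
  expands a F -> 0 <= r < 1 -> ex_series (fun k => Cmod (a k) * r ^ k).
Proof.
  intros HF Hr.
  set (s := (1 + r) / 2).
  assert (Hs : 0 < s < 1) by (unfold s; lra).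
  destruct (series_terms_bounded _ _ (HF (RtoC s) ltac:(
    unfold unit_disk; rewrite Cmod_R, Rabs_pos_eq; lra))) as [B HB].
  assert (Hq : 0 <= r / s < 1).
  { split; [apply Rdiv_le_0_compat; lra |].
    apply Rmult_lt_reg_r with s; [lra |]. unfold Rdiv. rewrite Rmult_assoc, Rinv_l; unfold s; lra. }
  apply (@ex_series_le R_AbsRing R_CompleteNormedModule _ (fun k => B * (r / s) ^ k)).
  - intro k. change (Rabs (Cmod (a k) * r ^ k) <= B * (r / s) ^ k).
    rewrite Rabs_pos_eq.
    2: { apply Rmult_le_pos; [apply Cmod_ge_0 | apply pow_le; lra]. }
    replace (Cmod (a k) * r ^ k) with ((Cmod (a k) * s ^ k) * (r / s) ^ k).
    + apply Rmult_le_compat_r; [apply pow_le; lra |].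
      generalize (HB k). rewrite Cmod_mult, Cmod_pow, Cmod_R, (Rabs_pos_eq s); lra.
    + rewrite Rmult_assoc, <- Rpow_mult_distr. f_equal. f_equal. field. lra.
  - apply (@ex_series_scal_l R_AbsRing R_NormedModule). apply ex_series_geom. rewrite Rabs_pos_eq; lra.
Qed.

(** * Uniform second-order Taylor expansion *)

(** The coefficient of h^j in (z + h)^k, that is binom(k, j) z^(k-j).  The
    recursion on k avoids truncated exponents and gives [taylor_coef_bound]
    by a direct induction. *)
Fixpoint taylor_coef (z : C) (j k : nat) : C :=
  match k with
  | 0%nat => match j with 0%nat => RtoC 1 | S _ => RtoC 0 end
  | S k' =>
      (z * taylor_coef z j k' +
       match j with 0%nat => RtoC 0 | S j' => taylor_coef z j' k' end)%C
  end.

(** The cofactor of h^3 in (z + h)^k, with w = z + h: multiplying by w turns the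
    term of degree 2 of the k-th power into a new contribution of degree 3. *)
Fixpoint taylor_rem (z w : C) (k : nat) : C :=
  match k with
  | 0%nat => RtoC 0
  | S k' => (w * taylor_rem z w k' + taylor_coef z 2 k')%C
  end.

Lemma taylor_coef_0 (z : C) (k : nat) : taylor_coef z 0 k = (z ^ k)%C.
Proof. induction k as [|k IH]; simpl; [reflexivity | rewrite IH; ring]. Qed.

Lemma taylor_coef_1 (z : C) (k : nat) :
  taylor_coef z 1 (S k) = (RtoC (INR (S k)) * z ^ k)%C.
Proof.
  induction k as [|k IH].
  - simpl. ring.
  - change (taylor_coef z 1 (S (S k)))
      with (z * taylor_coef z 1 (S k) + taylor_coef z 0 (S k))%C.
    rewrite IH, taylor_coef_0, (S_INR (S k)), RtoC_plus, Cpow_S. ring.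
Qed.

Lemma pow_taylor (z h : C) (k : nat) :
  ((z + h) ^ k = z ^ k + taylor_coef z 1 k * h + taylor_coef z 2 k * h ^ 2
                 + taylor_rem z (z + h) k * h ^ 3)%C.
Proof.
  induction k as [|k IH].
  - simpl. ring.
  - rewrite Cpow_S, IH at 1.
    change (taylor_coef z 1 (S k)) with (z * taylor_coef z 1 k + taylor_coef z 0 k)%C.
    change (taylor_coef z 2 (S k)) with (z * taylor_coef z 2 k + taylor_coef z 1 k)%C.
    change (taylor_rem z (z + h) (S k))
      with ((z + h) * taylor_rem z (z + h) k + taylor_coef z 2 k)%C.
    rewrite taylor_coef_0, (Cpow_S z k). ring.
Qed.

(** The left side is dominated by one term of the binomial expansion of
    (r + eta)^k.  This bounds all Taylor data by the geometric factor for which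
    the coefficients of a power series are known to be summable. *)
Lemma taylor_coef_bound (z : C) (r eta : R) (j k : nat) :
  Cmod z <= r -> 0 <= eta -> Cmod (taylor_coef z j k) * eta ^ j <= (r + eta) ^ k.
Proof.
  intros Hz He. generalize (Cmod_ge_0 z). intro Hz0. revert j.
  induction k as [|k IH]; intros [|j].
  - simpl. rewrite Cmod_1. lra.
  - change (Cmod (RtoC 0) * eta ^ S j <= 1). rewrite Cmod_0. lra.
  - rewrite taylor_coef_0, Cmod_pow. simpl (eta ^ 0). rewrite Rmult_1_r.
    apply pow_incr. lra.
  - change (taylor_coef z (S j) (S k))
      with (z * taylor_coef z (S j) k + taylor_coef z j k)%C.
    eapply Rle_trans;
      [apply Rmult_le_compat_r; [apply pow_le; lra | apply Cmod_triangle] |].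
    rewrite Cmod_mult. change (eta ^ S j) with (eta * eta ^ j).
    change ((r + eta) ^ S k) with ((r + eta) * (r + eta) ^ k).
    generalize (IH (S j)) (IH j). change (eta ^ S j) with (eta * eta ^ j). intros H1 H2.
    assert (0 <= (r + eta) ^ k) by (apply pow_le; lra).
    assert (Cmod z * (Cmod (taylor_coef z (S j) k) * (eta * eta ^ j)) <= r * (r + eta) ^ k).
    { apply Rmult_le_compat; try lra. apply Rmult_le_pos; [apply Cmod_ge_0 |].
      apply Rmult_le_pos; [lra | apply pow_le; lra]. }
    assert (eta * (Cmod (taylor_coef z j k) * eta ^ j) <= eta * (r + eta) ^ k)
      by (apply Rmult_le_compat_l; lra).
    lra.
Qed.

Lemma taylor_rem_bound (z w : C) (r eta : R) (k : nat) :
  Cmod z <= r -> Cmod w <= r -> 0 <= eta ->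
  Cmod (taylor_rem z w k) * eta ^ 3 <= (r + eta) ^ k.
Proof.
  intros Hz Hw He. generalize (Cmod_ge_0 w). intro Hw0.
  assert (He2 : 0 <= eta ^ 2) by (apply pow_le; lra).
  induction k as [|k IH].
  - change (Cmod (RtoC 0) * eta ^ 3 <= 1). rewrite Cmod_0. lra.
  - change (taylor_rem z w (S k)) with (w * taylor_rem z w k + taylor_coef z 2 k)%C.
    change ((r + eta) ^ S k) with ((r + eta) * (r + eta) ^ k).
    eapply Rle_trans;
      [apply Rmult_le_compat_r; [apply pow_le; lra | apply Cmod_triangle] |].
    rewrite Cmod_mult.
    generalize (taylor_coef_bound z r eta 2 k Hz He). intro H2.
    assert (Cmod w * (Cmod (taylor_rem z w k) * eta ^ 3) <= r * (r + eta) ^ k).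
    { apply Rmult_le_compat; try lra. apply Rmult_le_pos; [apply Cmod_ge_0 | apply pow_le; lra]. }
    assert (eta * (Cmod (taylor_coef z 2 k) * eta ^ 2) <= eta * (r + eta) ^ k)
      by (apply Rmult_le_compat_l; lra).
    change (eta ^ 3) with (eta * eta ^ 2) in *. lra.
Qed.

Definition derived_coef (a : nat -> C) (k : nat) : C := (RtoC (INR (S k)) * a (S k))%C.

(** The constants depend on r alone; both sup arguments below need this
    uniformity.  The bounds on [F] and [F2] make the suprema finite and let the
    quadratic term be absorbed in first-order arguments. *)
Definition taylor2_on_disk (F F1 F2 : C -> C) : Prop :=
  forall r, 0 <= r < 1 -> exists B, 0 <= B /\ forall z, Cmod z <= r ->
      Cmod (F z) <= B /\ Cmod (F2 z) <= B /\
      forall h, Cmod (z + h) <= r ->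
        Cmod (F (z + h) - F z - F1 z * h - F2 z * h ^ 2)%C <= B * Cmod h ^ 3.

(** Sum the expansions of (z + h)^k against the coefficients: with
    r + eta < 1, the geometric bounds above make the coefficients of h, of h^2
    and of the remainder converge, uniformly for |z| <= r. *)
Lemma expands_taylor (a : nat -> C) (F : C -> C) :
  expands a F ->
  exists F1 F2 : C -> C,
    expands (derived_coef a) F1 /\ taylor2_on_disk F F1 F2.
Proof.
  intro HF.
  assert (Hdom : forall (u : nat -> C) (r eta c : R), 0 <= r -> 0 < eta -> r + eta < 1 -> 0 < c ->
    (forall k, Cmod (u k) * c <= (r + eta) ^ k) ->
    ex_series (fun k => / c * (Cmod (a k) * (r + eta) ^ k)) /\
    forall k, Cmod (a k * u k)%C <= / c * (Cmod (a k) * (r + eta) ^ k)).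
  { intros u r eta c Hr Heta Hre Hc Hu. split.
    - apply (@ex_series_scal_l R_AbsRing R_NormedModule).
      apply expands_abs with F; [exact HF | lra].
    - intro k. rewrite Cmod_mult. apply Rmult_le_reg_l with c; [exact Hc |].
      rewrite <- (Rmult_assoc c (/ c)), Rinv_r, Rmult_1_l by lra.
      replace (c * (Cmod (a k) * Cmod (u k))) with (Cmod (a k) * (Cmod (u k) * c)) by ring.
      apply Rmult_le_compat_l; [apply Cmod_ge_0 | apply Hu]. }
  assert (Hex : forall j z, unit_disk z -> exists l,
    @is_series C_AbsRing C_NormedModule (fun k => a k * taylor_coef z j k)%C l).
  { intros j z Hz. unfold unit_disk in Hz. generalize (Cmod_ge_0 z). intro Hz0.
    set (eta := (1 - Cmod z) / 2).
    assert (Heta : 0 < eta) by (unfold eta; lra).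
    destruct (Hdom (taylor_coef z j) (Cmod z) eta (eta ^ j)) as [H1 H2];
      [lra | lra | unfold eta; lra | apply pow_lt; lra | | ].
    - intro k. apply taylor_coef_bound; lra.
    - destruct (@ex_series_le C_AbsRing C_CompleteNormedModule
        (fun k => a k * taylor_coef z j k)%C _ H2 H1) as [l Hl].
      exists l. exact Hl. }
  assert (Hch : forall j, exists G : C -> C, forall z, unit_disk z ->
    @is_series C_AbsRing C_NormedModule (fun k => a k * taylor_coef z j k)%C (G z)).
  { intro j.
    assert (H : forall z, exists l, unit_disk z ->
      @is_series C_AbsRing C_NormedModule (fun k => a k * taylor_coef z j k)%C l).
    { intro z. destruct (classic (unit_disk z)) as [Hz|Hz].
      - destruct (Hex j z Hz) as [l Hl]. now exists l.
      - exists (RtoC 0). intro; contradiction. }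
    exists (fun z => proj1_sig (constructive_indefinite_description _ (H z))).
    intro z. exact (proj2_sig (constructive_indefinite_description _ (H z))). }
  destruct (Hch 1%nat) as [F1 HF1]. destruct (Hch 2%nat) as [F2 HF2].
  exists F1, F2. split.
  - intros z Hz.
    apply (is_series_ext (fun k => a (S k) * taylor_coef z 1 (S k))%C).
    { intro k. rewrite taylor_coef_1. unfold derived_coef.
      rewrite Cmult_assoc. f_equal. apply Cmult_comm. }
    apply (@is_series_incr_1 C_AbsRing C_NormedModule (fun k => a k * taylor_coef z 1 k)%C).
    match goal with |- is_series _ ?l => replace l with (F1 z) end;
      [exact (HF1 z Hz) |].
    change (F1 z = F1 z + a 0%nat * RtoC 0)%C. ring.
  - intros r Hr. set (eta := (1 - r) / 2).
    assert (Heta : 0 < eta <= 1) by (unfold eta; lra).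
    assert (Hre : r + eta < 1) by (unfold eta; lra).
    set (S0 := Series (fun k => Cmod (a k) * (r + eta) ^ k)).
    assert (HS0 : 0 <= S0).
    { rewrite <- (Rmult_0_l (Series (fun k => Cmod (a k) * (r + eta) ^ k))).
      unfold S0. rewrite <- Series_scal_l. apply Series_le.
      - intro k. assert (0 <= Cmod (a k) * (r + eta) ^ k).
        { apply Rmult_le_pos; [apply Cmod_ge_0 | apply pow_le; lra]. }
        lra.
      - apply expands_abs with F; [exact HF | lra]. }
    (* Since eta <= 1, the single constant S0 / eta^3 serves all orders up to 3. *)
    assert (Hbd : forall j (u : nat -> C) l, (j <= 3)%nat ->
      (forall k, Cmod (u k) * eta ^ j <= (r + eta) ^ k) ->
      @is_series C_AbsRing C_NormedModule (fun k => a k * u k)%C l ->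
      Cmod l <= S0 / eta ^ 3).
    { intros j u l Hj Hu Hl.
      assert (Hu3 : forall k, Cmod (u k) * eta ^ 3 <= (r + eta) ^ k).
      { intro k. eapply Rle_trans; [| apply Hu]. apply Rmult_le_compat_l; [apply Cmod_ge_0 |].
        replace 3%nat with (j + (3 - j))%nat by lia. rewrite pow_add.
        rewrite <- (Rmult_1_r (eta ^ j)) at 2.
        apply Rmult_le_compat_l; [apply pow_le; lra |].
        rewrite <- (pow1 (3 - j)). apply pow_incr. lra. }
      assert (H3 : 0 < eta ^ 3) by (apply pow_lt; lra).
      destruct (Hdom u r eta (eta ^ 3)) as [H1 H2]; try lra; try exact Hu3.
      generalize (Cmod_series_le _ _ _ Hl H2 H1). rewrite Series_scal_l.
      fold S0. unfold Rdiv. lra. }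
    exists (S0 / eta ^ 3). split.
    { apply Rdiv_le_0_compat; [lra | apply pow_lt; lra]. }
    intros z Hz.
    assert (Hzd : unit_disk z) by (unfold unit_disk; lra).
    split; [| split].
    + apply (Hbd 0%nat (fun k => z ^ k)%C); [lia | | exact (HF z Hzd)].
      intro k. rewrite <- taylor_coef_0. apply taylor_coef_bound; lra.
    + apply (Hbd 2%nat (taylor_coef z 2)); [lia | | exact (HF2 z Hzd)].
      intro k. apply taylor_coef_bound; lra.
    + intros h Hh.
      assert (Hwd : unit_disk (z + h)%C) by (unfold unit_disk; lra).
      (* The remainder is bounded through its quotient by h^3. *)
      destruct (Ceq_dec h (RtoC 0)) as [-> | Hh0].
      { rewrite Cmod_0. replace (z + RtoC 0)%C with z by ring.
        replace (F z - F z - F1 z * RtoC 0 - F2 z * RtoC 0 ^ 2)%C with (RtoC 0) by ring.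
        rewrite Cmod_0. simpl. lra. }
      set (Rm := (F (z + h) - F z - F1 z * h - F2 z * h ^ 2)%C).
      replace Rm with (Rm / h ^ 3 * h ^ 3)%C by (field; exact Hh0).
      rewrite Cmod_mult, Cmod_pow.
      apply Rmult_le_compat_r; [apply pow_le, Cmod_ge_0 |].
      apply (Hbd 3%nat (taylor_rem z (z + h))); [lia | |].
      { intro k. apply taylor_rem_bound; lra. }
      generalize (@is_series_scal C_AbsRing C_NormedModule (/ h ^ 3)%C _ _
        (@is_series_minus C_AbsRing C_NormedModule _ _ _ _
        (@is_series_minus C_AbsRing C_NormedModule _ _ _ _
          (@is_series_minus C_AbsRing C_NormedModule _ _ _ _ (HF _ Hwd) (HF z Hzd))
          (@is_series_scal C_AbsRing C_NormedModule h _ _ (HF1 z Hzd)))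
          (@is_series_scal C_AbsRing C_NormedModule (h ^ 2)%C _ _ (HF2 z Hzd)))).
      intro H.
      replace (Rm / h ^ 3)%C with
        (/ h ^ 3 * (F (z + h) + - F z + - (h * F1 z) + - (h ^ 2 * F2 z)))%C
        by (unfold Rm; field; exact Hh0).
      revert H. apply is_series_ext. intro k.
      change (/ h ^ 3 * (a k * (z + h) ^ k + - (a k * z ^ k)
        + - (h * (a k * taylor_coef z 1 k)) + - (h ^ 2 * (a k * taylor_coef z 2 k)))
        = a k * taylor_rem z (z + h) k)%C.
      rewrite (pow_taylor z h k). field. exact Hh0.
Qed.


Lemma taylor2_is_derive (F F1 F2 : C -> C) (z : C) :
  taylor2_on_disk F F1 F2 -> unit_disk z ->
  @is_derive C_AbsRing C_NormedModule F z (F1 z).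
Proof.
  intros HT Hz. unfold unit_disk in Hz. generalize (Cmod_ge_0 z); intro Hz0.
  destruct (HT ((1 + Cmod z) / 2)) as [B [HB HTz]]; [lra |].
  destruct (HTz z) as [_ [HF2 HR]]; [lra |].
  split; [apply is_linear_scal_l |].
  intros x Hx eps.
  rewrite <- (@is_filter_lim_locally_unique C_AbsRing (AbsRing_NormedModule C_AbsRing) _ _ Hx).
  destruct eps as [e He]; simpl.
  set (d := Rmin ((1 - Cmod z) / 2) (e / (2 * B + 1))).
  assert (Hd0 : 0 < d).
  { unfold d. apply Rmin_pos; [lra | apply Rdiv_lt_0_compat; lra]. }
  exists (mkposreal d Hd0). intros y Hy.
  set (h := (y - z)%C).
  change (Cmod h < d) in Hy.
  change (Cmod (F y - F z - h * F1 z)%C <= e * Cmod h).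
  assert (Hd1 : d <= (1 - Cmod z) / 2) by apply Rmin_l.
  assert (Hd2 : d <= e / (2 * B + 1)) by apply Rmin_r.
  replace y with (z + h)%C by (unfold h; ring).
  assert (Hzh : Cmod (z + h) <= (1 + Cmod z) / 2).
  { eapply Rle_trans; [apply Cmod_triangle | lra]. }
  replace (F (z + h) - F z - h * F1 z)%C
    with ((F (z + h) - F z - F1 z * h - F2 z * h ^ 2) + F2 z * h ^ 2)%C by ring.
  eapply Rle_trans; [apply Cmod_triangle |].
  rewrite Cmod_mult, Cmod_pow. specialize (HR h Hzh).
  set (t := Cmod h) in *. assert (Ht : 0 <= t) by apply Cmod_ge_0.
  assert (H1 : Cmod (F2 z) * t ^ 2 <= B * t ^ 2).
  { apply Rmult_le_compat_r; [apply pow_le; lra | lra]. }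
  assert (H2 : B * t ^ 3 <= B * t ^ 2).
  { apply Rmult_le_compat_l; [lra |]. simpl. rewrite Rmult_1_r.
    assert (0 <= t * t) by nra. nra. }
  assert (H3 : t * (2 * B + 1) <= e).
  { apply Rle_trans with (e / (2 * B + 1) * (2 * B + 1)); [| right; field; lra].
    apply Rmult_le_compat_r; lra. }
  simpl in *. nra.
Qed.

(** * Maximum principle and Schwarz lemma *)

Lemma Cmod2_pair (x y : R) : Cmod (x, y) ^ 2 = x ^ 2 + y ^ 2.
Proof. rewrite Cmod2_alt. reflexivity. Qed.

(** |G| + e |z|^2 is strictly subharmonic in a discrete sense: at a point with
    |z| < s it lies below its supremum m by at least e h^2 / 2.  Hence m is
    approached only on the annulus. *)
Lemma max_modulus_annulus (G G1 G2 : C -> C) (s r B : R) :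
  taylor2_on_disk G G1 G2 -> 0 <= s < r -> r < 1 ->
  (forall z, s <= Cmod z <= r -> Cmod (G z) <= B) ->
  forall z, Cmod z <= r -> Cmod (G z) <= B.
Proof.
  intros HT Hs Hr HB z0 Hz0.
  apply le_epsilon. intros e He.
  destruct (HT r) as [T [HT0 HTr]]; [lra |].
  set (v := fun z => Cmod (G z) + e * Cmod z ^ 2).
  (* Small enough that the four neighbours stay in |z| <= r and that the four
     cubic remainders use up at most half of the gain 4 e h^2. *)
  set (h := Rmin (r - s) (2 * e / (4 * T + 1))).
  assert (Hh0 : 0 < h).
  { apply Rmin_pos; [lra | apply Rdiv_lt_0_compat; lra]. }
  assert (Hh1 : h <= r - s) by apply Rmin_l.
  assert (Hh2 : 4 * T * h <= 2 * e).
  { assert (h <= 2 * e / (4 * T + 1)) by apply Rmin_r.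
    apply Rle_trans with (2 * e / (4 * T + 1) * (4 * T + 1)); [| right; field; lra].
    apply Rle_trans with (h * (4 * T + 1)); [lra |].
    apply Rmult_le_compat_r; lra. }
  destruct (completeness (fun x => exists z, Cmod z <= r /\ x = v z)) as [m [Hub Hlub]].
  { exists (T + e). intros x [z [Hz ->]]. unfold v.
    destruct (HTr z Hz) as [H _]. generalize (Cmod_ge_0 z); intro. simpl.
    assert (Cmod z * (Cmod z * 1) <= 1) by nra. nra. }
  { exists (v z0), z0. now split. }
  assert (Hm : forall z, Cmod z <= r -> v z <= m).
  { intros z Hz. apply Hub. now exists z. }
  assert (Hstep : forall z, Cmod z <= r -> v z <= Rmax (B + e) (m - e * h ^ 2 / 2)).
  { intros z Hz. generalize (Cmod_ge_0 z); intro Hz'.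
    destruct (Rle_lt_dec s (Cmod z)) as [Hsz | Hsz].
    - eapply Rle_trans; [| apply Rmax_l]. unfold v.
      specialize (HB z (conj Hsz Hz)).
      simpl. assert (Cmod z * (Cmod z * 1) <= 1) by nra. nra.
    - eapply Rle_trans; [| apply Rmax_r].
      assert (Hdir : forall u, Cmod u = h ->
        v (z + u)%C <= m /\
        Cmod (G (z + u) - G z - G1 z * u - G2 z * u ^ 2)%C <= T * h ^ 3).
      { intros u Hu.
        assert (Hzu : Cmod (z + u) <= r).
        { eapply Rle_trans; [apply Cmod_triangle | lra]. }
        split; [now apply Hm |].
        destruct (HTr z Hz) as [_ [_ H]]. rewrite <- Hu. now apply H. }
      assert (Hmod : forall x y, x ^ 2 + y ^ 2 = h ^ 2 -> Cmod (x, y) = h).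
      { intros x y Hxy. unfold Cmod. simpl fst; simpl snd. rewrite Hxy.
        apply sqrt_pow2. lra. }
      set (u1 := (h, 0) : C). set (u2 := (- h, 0) : C).
      set (u3 := (0, h) : C). set (u4 := (0, - h) : C).
      destruct (Hdir u1) as [V1 R1]; [unfold u1; apply Hmod; ring |].
      destruct (Hdir u2) as [V2 R2]; [unfold u2; apply Hmod; ring |].
      destruct (Hdir u3) as [V3 R3]; [unfold u3; apply Hmod; ring |].
      destruct (Hdir u4) as [V4 R4]; [unfold u4; apply Hmod; ring |].
      assert (HG : 4 * Cmod (G z) <=
        Cmod (G (z + u1)%C) + Cmod (G (z + u2)%C) +
        Cmod (G (z + u3)%C) + Cmod (G (z + u4)%C) + 4 * (T * h ^ 3)).
      { set (rem := fun u : C => (G (z + u) - G z - G1 z * u - G2 z * u ^ 2)%C).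
        fold (rem u1) in R1. fold (rem u2) in R2.
        fold (rem u3) in R3. fold (rem u4) in R4.
        assert (E : (RtoC 4 * G z)%C =
          (G (z + u1) + G (z + u2) + G (z + u3) + G (z + u4)
           - rem u1 - rem u2 - rem u3 - rem u4)%C).
        (* The four directions and their squares both sum to 0. *)
        { unfold rem.
          generalize (G (z + u1)%C) (G (z + u2)%C)
            (G (z + u3)%C) (G (z + u4)%C) (G z) (G1 z) (G2 z).
          intros [a1 a2] [b1 b2] [c1 c2] [d1 d2] [g1 g2] [p1 p2] [q1 q2].
          unfold u1, u2, u3, u4. apply injective_projections; simpl; ring. }
        assert (E4 : 4 * Cmod (G z) = Cmod (RtoC 4 * G z)%C).
        { rewrite Cmod_mult, Cmod_R, Rabs_pos_eq; lra. }
        rewrite E4, E. unfold Cminus.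
        assert (Hsum : forall a b c d : C, Cmod (a + b + c + d)%C <= Cmod a + Cmod b + Cmod c + Cmod d).
        { intros a b c d. generalize (Cmod_triangle (a + b + c) d) (Cmod_triangle (a + b) c)
            (Cmod_triangle a b). lra. }
        assert (Htri : forall a b c d e : C, Cmod (a + - b + - c + - d + - e)%C
          <= Cmod a + Cmod b + Cmod c + Cmod d + Cmod e).
        { intros a b c d e0.
          generalize (Cmod_triangle (a + - b + - c + - d) (- e0))
            (Cmod_triangle (a + - b + - c) (- d)) (Cmod_triangle (a + - b) (- c))
            (Cmod_triangle a (- b)). rewrite !Cmod_opp. lra. }
        eapply Rle_trans; [apply Htri |].
        generalize (Hsum (G (z + u1)%C) (G (z + u2)%C)
            (G (z + u3)%C) (G (z + u4)%C)). lra. }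
      unfold v in *.
      assert (Hsq : Cmod (z + u1)%C ^ 2 + Cmod (z + u2)%C ^ 2 +
        Cmod (z + u3)%C ^ 2 + Cmod (z + u4)%C ^ 2 = 4 * Cmod z ^ 2 + 4 * h ^ 2).
      { destruct z as [x y]. unfold u1, u2, u3, u4, Cplus. simpl fst; simpl snd. rewrite !Cmod2_pair. ring. }
      assert (Hh3 : 4 * (T * h ^ 3) <= 2 * e * h ^ 2).
      { replace (4 * (T * h ^ 3)) with (4 * T * h * h ^ 2) by ring.
        apply Rmult_le_compat_r; [apply pow_le; lra | exact Hh2]. }
      nra. }
  assert (Hfin : m <= Rmax (B + e) (m - e * h ^ 2 / 2)).
  { apply Hlub. intros x [z [Hz ->]]. now apply Hstep. }
  assert (0 < e * h ^ 2) by (apply Rmult_lt_0_compat; [lra | apply pow_lt; lra]).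
  assert (m <= B + e).
  { unfold Rmax in Hfin. destruct Rle_dec; lra. }
  generalize (Hm z0 Hz0). unfold v. generalize (pow_le (Cmod z0) 2 (Cmod_ge_0 z0)). nra.
Qed.

Lemma bernoulli (d : R) (n : nat) : 0 <= d <= 1 -> 1 - INR n * d <= (1 - d) ^ n.
Proof.
  intro Hd. induction n as [|n IH]; [simpl; lra |].
  rewrite S_INR. change ((1 - d) ^ S n) with ((1 - d) * (1 - d) ^ n).
  generalize (pos_INR n). nra.
Qed.

(** On s <= |w| the hypothesis gives |Q w| <= K / s^n; the maximum principle
    carries this inside, and s tends to 1. *)
Lemma schwarz_order (Q Q1 Q2 : C -> C) (n : nat) (K : R) :
  taylor2_on_disk Q Q1 Q2 ->
  (forall z, unit_disk z -> Cmod z ^ n * Cmod (Q z) <= K) ->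
  forall z, unit_disk z -> Cmod (Q z) <= K.
Proof.
  intros HT HK z Hz. unfold unit_disk in *. generalize (Cmod_ge_0 z); intro Hz0.
  assert (Hs : forall s, Cmod z <= s -> 0 < s < 1 -> s ^ n * Cmod (Q z) <= K).
  { intros s Hzs Hs01. assert (Hsn : 0 < s ^ n) by (apply pow_lt; lra).
    assert (H : Cmod (Q z) <= K / s ^ n).
    { apply (max_modulus_annulus Q Q1 Q2 s ((1 + s) / 2)); try lra; [exact HT |].
      intros w Hw. apply Rmult_le_reg_l with (s ^ n); [lra |].
      replace (s ^ n * (K / s ^ n)) with K by (field; lra).
      eapply Rle_trans; [| apply (HK w); lra].
      apply Rmult_le_compat_r; [apply Cmod_ge_0 | apply pow_incr; lra]. }
    apply Rle_trans with (s ^ n * (K / s ^ n)); [| right; field; lra].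
    apply Rmult_le_compat_l; lra. }
  apply Rnot_lt_le. intro Hlt.
  assert (HK0 : 0 <= K).
  { apply Rle_trans with (2 := HK z Hz).
    apply Rmult_le_pos; [apply pow_le; lra | apply Cmod_ge_0]. }
  set (q := Cmod (Q z)) in *.
  (* With this d, Bernoulli's inequality makes (1 - d)^n q exceed K. *)
  set (d := Rmin ((1 - Cmod z) / 2) ((q - K) / ((INR n + 1) * q))).
  generalize (pos_INR n); intro Hn.
  assert (Hnq : 0 < (INR n + 1) * q) by (apply Rmult_lt_0_compat; lra).
  assert (Hd0 : 0 < d).
  { apply Rmin_pos; [lra | apply Rdiv_lt_0_compat; lra]. }
  assert (Hd1 : d <= (1 - Cmod z) / 2) by apply Rmin_l.
  assert (Hd2 : d * ((INR n + 1) * q) <= q - K).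
  { apply Rle_trans with ((q - K) / ((INR n + 1) * q) * ((INR n + 1) * q)); [| right; field; split; nra].
    apply Rmult_le_compat_r; [lra | apply Rmin_r]. }
  generalize (Hs (1 - d) ltac:(lra) ltac:(lra)) (bernoulli d n ltac:(lra)).
  intros H1 H2.
  assert ((1 - INR n * d) * q <= (1 - d) ^ n * q) by (apply Rmult_le_compat_r; lra).
  assert (0 < d * q) by (apply Rmult_lt_0_compat; lra).
  nra.
Qed.

(** * The operator z P' + c P *)

Lemma Cmod_contract (c : C) (d : R) :
  0 <= d <= 2 * Re c -> Cmod (c - RtoC d)%C <= Cmod c.
Proof.
  intro Hd.
  destruct c as [x y]. simpl in Hd.
  unfold Cmod. apply sqrt_le_1_alt. simpl. nra.
Qed.

(** One Euler step of size d along the spiral z exp(-t/c), on which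
    P - dP/dt = Q/c (with Q = z P' + c P), compares |P z| with |P| at a point of no larger modulus,
    at the cost of an error O(d^2). *)
Lemma first_order_bound (P P1 P2 : C -> C) (c : C) (M : R) :
  taylor2_on_disk P P1 P2 -> 0 < Re c ->
  (forall z, unit_disk z -> Cmod (z * P1 z + c * P z)%C <= M * Cmod c) ->
  forall z, unit_disk z -> Cmod (P z) <= M.
Proof.
  intros HT Hc HQ z0 Hz0. unfold unit_disk in *.
  assert (Hc0 : c <> RtoC 0).
  { intros ->. simpl in Hc. lra. }
  assert (Hcm : 0 < Cmod c) by now apply Cmod_gt_0.
  set (r := Cmod z0) in *. assert (Hr : 0 <= r) by apply Cmod_ge_0.
  destruct (HT r) as [T [HT0 HTr]]; [lra |].
  destruct (completeness (fun x => exists z, Cmod z <= r /\ x = Cmod (P z))) as [m [Hub Hlub]].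
  { exists T. intros x [z [Hz ->]]. now apply HTr. }
  { exists (Cmod (P z0)), z0. split; [apply Rle_refl | reflexivity]. }
  assert (Hm : forall z, Cmod z <= r -> Cmod (P z) <= m).
  { intros z Hz. apply Hub. now exists z. }
  set (k := / Cmod c). assert (Hk : 0 < k) by now apply Rinv_0_lt_compat.
  set (A := T * (k ^ 2 + k ^ 3)).
  assert (HA : 0 <= A).
  { apply Rmult_le_pos; [lra |]. generalize (pow_lt k 2 Hk) (pow_lt k 3 Hk). lra. }
  assert (Hstep : forall d, 0 < d <= 1 -> d <= 2 * Re c -> m <= M + A * d).
  { intros d Hd1 Hd2.
    assert (Hall : m <= (m + d * M + A * d ^ 2) / (1 + d)).
    { apply Hlub. intros x [w [Hw ->]].
      apply Rmult_le_reg_r with (1 + d); [lra |].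
      replace ((m + d * M + A * d ^ 2) / (1 + d) * (1 + d))
        with (m + d * M + A * d ^ 2) by (field; lra).
      (* w + h = w (c - d) / c, and |c - d| <= |c|. *)
      set (h := (- RtoC d * w / c)%C).
      assert (Hh : Cmod h <= d * k).
      { unfold h, k. rewrite Cmod_div, Cmod_mult, Cmod_opp, Cmod_R, Rabs_pos_eq by (try assumption; lra).
        unfold Rdiv. apply Rmult_le_compat_r; [apply Rlt_le; exact Hk |].
        generalize (Cmod_ge_0 w). nra. }
      assert (Hwh : Cmod (w + h) <= r).
      { replace (w + h)%C with (w * ((c - RtoC d) / c))%C by (unfold h; field; exact Hc0).
        rewrite Cmod_mult, Cmod_div by exact Hc0.
        assert (Cmod (c - RtoC d) / Cmod c <= 1).
        { apply Rmult_le_reg_r with (Cmod c); [lra |].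
          unfold Rdiv. rewrite Rmult_assoc, Rinv_l, Rmult_1_l, Rmult_1_r by lra.
          apply Cmod_contract. lra. }
        generalize (Cmod_ge_0 w).
        assert (0 <= Cmod (c - RtoC d) / Cmod c) by (apply Rdiv_le_0_compat; [apply Cmod_ge_0 | lra]).
        nra. }
      destruct (HTr w Hw) as [_ [H2 HR]]. specialize (HR h Hwh).
      set (Rm := (P (w + h) - P w - P1 w * h - P2 w * h ^ 2)%C) in *.
      assert (E : (RtoC (1 + d) * P w)%C =
        (P (w + h) + RtoC d * ((w * P1 w + c * P w) / c) + - (P2 w * h ^ 2) + - Rm)%C).
      { unfold Rm. rewrite RtoC_plus. generalize (P (w + h)%C). intro X. unfold h. field. exact Hc0. }
      assert (Emod : Cmod (P w) * (1 + d) = Cmod (RtoC (1 + d) * P w)%C).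
      { rewrite Cmod_mult, Cmod_R, Rabs_pos_eq; lra. }
      rewrite Emod, E.
      assert (Hq : Cmod (RtoC d * ((w * P1 w + c * P w) / c))%C <= d * M).
      { rewrite Cmod_mult, Cmod_R, Rabs_pos_eq, Cmod_div by (try assumption; lra).
        apply Rmult_le_compat_l; [lra |].
        apply Rmult_le_reg_r with (Cmod c); [lra |].
        unfold Rdiv. rewrite Rmult_assoc, Rinv_l, Rmult_1_r by lra.
        apply HQ. lra. }
      assert (Hh0 : 0 <= Cmod h) by apply Cmod_ge_0.
      assert (Hh2 : Cmod h ^ 2 <= d ^ 2 * k ^ 2).
      { rewrite <- Rpow_mult_distr. apply pow_incr. lra. }
      assert (Hh3 : Cmod h ^ 3 <= d ^ 2 * k ^ 3).
      { apply Rle_trans with ((d * k) ^ 3); [apply pow_incr; lra |].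
        rewrite Rpow_mult_distr. apply Rmult_le_compat_r; [apply Rlt_le, pow_lt; lra |].
        simpl. nra. }
      assert (HP2 : Cmod (P2 w * h ^ 2)%C <= T * (d ^ 2 * k ^ 2)).
      { rewrite Cmod_mult, Cmod_pow. apply Rmult_le_compat;
          [apply Cmod_ge_0 | apply pow_le; lra | exact H2 | exact Hh2]. }
      assert (HR' : Cmod Rm <= T * (d ^ 2 * k ^ 3)).
      { eapply Rle_trans; [exact HR |]. apply Rmult_le_compat_l; lra. }
      set (X := (RtoC d * ((w * P1 w + c * P w) / c))%C) in *.
      generalize (Cmod_triangle (P (w + h)%C + X + - (P2 w * h ^ 2)) (- Rm))
        (Cmod_triangle (P (w + h)%C + X) (- (P2 w * h ^ 2)))
        (Cmod_triangle (P (w + h)%C) X).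
      rewrite !Cmod_opp. generalize (Hm _ Hwh). unfold A. intros. lra. }
    apply Rmult_le_compat_r with (r := 1 + d) in Hall; [| lra].
    replace ((m + d * M + A * d ^ 2) / (1 + d) * (1 + d))
      with (m + d * M + A * d ^ 2) in Hall by (field; lra).
    apply Rmult_le_reg_l with d; [lra |]. lra. }
  apply Rle_trans with m; [apply Hm, Rle_refl |].
  apply le_epsilon. intros e He.
  set (d := Rmin (Rmin 1 (2 * Re c)) (e / (A + 1))).
  assert (Hd0 : 0 < d).
  { repeat apply Rmin_pos; try lra. apply Rdiv_lt_0_compat; lra. }
  assert (Hd1 : d <= 1 /\ d <= 2 * Re c).
  { split; (eapply Rle_trans; [apply Rmin_l |]); [apply Rmin_l | apply Rmin_r]. }
  assert (Hd2 : d * (A + 1) <= e).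
  { apply Rle_trans with (e / (A + 1) * (A + 1)); [| right; field; lra].
    apply Rmult_le_compat_r; [lra | apply Rmin_r]. }
  generalize (Hstep d ltac:(lra) ltac:(lra)). nra.
Qed.

(** * Coefficient manipulations *)

Lemma expands_drop_const (a : nat -> C) (F : C -> C) :
  expands a F ->
  expands (fun k => match k with 0%nat => RtoC 0 | S _ => a k end)
          (fun z => F z - a 0%nat)%C.
Proof.
  intros H z Hz.
  apply (@is_series_decr_1 C_AbsRing C_NormedModule).
  apply (@is_series_incr_1 C_AbsRing C_NormedModule (fun k => a k * z ^ k)%C).
  match goal with |- is_series _ ?l => replace l with (F z) end; [exact (H z Hz) |].
  change (F z = F z - a 0%nat + - (RtoC 0 * 1) + a 0%nat * 1)%C. ring.
Qed.

Lemma expands_mul_derived (a : nat -> C) (F1 : C -> C) :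
  expands (derived_coef a) F1 -> expands (fun k => RtoC (INR k) * a k)%C (fun z => z * F1 z)%C.
Proof.
  intros H z Hz.
  apply (@is_series_decr_1 C_AbsRing C_NormedModule).
  match goal with |- is_series _ ?l => replace l with (z * F1 z)%C end.
  2: { change (z * F1 z = z * F1 z + - (RtoC 0 * a 0%nat * 1))%C. ring. }
  generalize (@is_series_scal C_AbsRing C_NormedModule z _ _ (H z Hz)).
  apply is_series_ext. intro k.
  change (z * (derived_coef a k * z ^ k) = RtoC (INR (S k)) * a (S k) * (z * z ^ k))%C.
  unfold derived_coef. ring.
Qed.

Lemma expands_lin (a b : nat -> C) (F G : C -> C) (c : C) :
  expands a F -> expands b G ->
  expands (fun k => a k + c * b k)%C (fun z => F z + c * G z)%C.
Proof.
  intros HF HG z Hz.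
  generalize (@is_series_plus C_AbsRing C_NormedModule _ _ _ _ (HF z Hz)
    (@is_series_scal C_AbsRing C_NormedModule c _ _ (HG z Hz))).
  apply is_series_ext. intro k.
  change (a k * z ^ k + c * (b k * z ^ k) = (a k + c * b k) * z ^ k)%C. ring.
Qed.

Lemma expands_unique (a : nat -> C) (F G : C -> C) :
  expands a F -> expands a G -> forall z, unit_disk z -> F z = G z.
Proof.
  intros HF HG z Hz.
  exact (@filterlim_locally_unique nat C_AbsRing C_NormedModule eventually _ _ _ _
    (HF z Hz) (HG z Hz)).
Qed.

(** Only z = 0 needs care: there the quotient has to be replaced by the
    coefficient [a 1]. *)
Lemma expands_shift (a : nat -> C) (F : C -> C) :
  expands a F -> a 0%nat = RtoC 0 ->
  exists G, expands (fun k => a (S k)) G /\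
    forall z, unit_disk z -> F z = (z * G z)%C.
Proof.
  intros HF H0.
  exists (fun z => if Ceq_dec z (RtoC 0) then a 1%nat else (F z / z)%C).
  assert (HF0 : forall G, expands G F -> F (RtoC 0) = G 0%nat).
  { intros G HG.
    assert (Hd : unit_disk (RtoC 0)) by (unfold unit_disk; rewrite Cmod_0; lra).
    apply (@filterlim_locally_unique nat C_AbsRing C_NormedModule eventually _ _ _ _ (HG _ Hd)).
    apply (is_series_ext (fun k => scal (pow_n (zero : C_AbsRing) k) (G k : C_NormedModule))).
    - intro k. change (Cmult (@pow_n C_Ring (RtoC 0) k) (G k) = G k * RtoC 0 ^ k)%C.
      rewrite pow_n_Cpow. ring.
    - exact (@is_pseries_0 C_AbsRing C_NormedModule G). }
  split.
  - intros z Hz. destruct (Ceq_dec z (RtoC 0)) as [-> | Hz0].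
    + generalize (@is_pseries_0 C_AbsRing C_NormedModule (fun k => a (S k))).
      apply is_series_ext. intro k.
      change (Cmult (@pow_n C_Ring (RtoC 0) k) (a (S k)) = a (S k) * RtoC 0 ^ k)%C.
      rewrite pow_n_Cpow. ring.
    + assert (H : @is_series C_AbsRing C_NormedModule (fun k => a (S k) * z ^ S k)%C (F z)).
      { apply (@is_series_incr_1 C_AbsRing C_NormedModule (fun k => a k * z ^ k)%C).
        match goal with |- is_series _ ?l => replace l with (F z) end; [exact (HF z Hz) |].
        change (F z = F z + a 0%nat * 1)%C. rewrite H0. ring. }
      generalize (@is_series_scal C_AbsRing C_NormedModule (/ z)%C _ _ H).
      change (scal (/ z)%C (F z : C_NormedModule)) with (/ z * F z)%C.
      rewrite (Cmult_comm (/ z) (F z)).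
      apply is_series_ext. intro k.
      change (/ z * (a (S k) * (z * z ^ k)) = a (S k) * z ^ k)%C. field. exact Hz0.
  - intros z Hz. destruct (Ceq_dec z (RtoC 0)) as [-> | Hz0].
    + rewrite (HF0 a HF), H0. ring.
    + field. exact Hz0.
Qed.

Lemma expands_factor (n : nat) (a : nat -> C) (F : C -> C) :
  expands a F -> (forall k, (k < n)%nat -> a k = RtoC 0) ->
  exists G, expands (fun k => a (n + k)%nat) G /\
    forall z, unit_disk z -> F z = (z ^ n * G z)%C.
Proof.
  revert a F. induction n as [|n IH]; intros a F HF Ha.
  - exists F. split; [exact HF |]. intros z _. simpl. ring.
  - destruct (expands_shift a F HF (Ha 0%nat ltac:(lia))) as [G [HG EG]].
    destruct (IH _ _ HG) as [H [HH EH]].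
    { intros k Hk. apply Ha. lia. }
    exists H. split; [exact HH |].
    intros z Hz. rewrite (EG z Hz), (EH z Hz), Cpow_S. ring.
Qed.

(** * The theorem *)

(** The factors Q of z p' - beta p and P of p satisfy Q = z P' + (n - beta) P
    because both sides have the coefficients (n + k - beta) b_(n+k); comparing
    coefficients spares differentiating the product z^n P. *)
Lemma theta_operator_bound (n : nat) (b : nat -> C) (p p1 : C -> C) (beta : C) (M : R) :
  expands b p -> expands (derived_coef b) p1 ->
  (forall k, (k < n)%nat -> b k = RtoC 0) -> Re beta < INR n ->
  (forall z, unit_disk z ->
     Cmod (z * p1 z - beta * p z)%C <= M * Cmod (RtoC (INR n) - beta)%C) ->
  forall z, unit_disk z -> Cmod (p z) <= M * Cmod z ^ n.
Proof.
  intros Hp Hp1 Hb Hbeta Hq.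
  destruct (expands_factor n b p Hp Hb) as [P [HP EP]].
  destruct (expands_taylor _ _ HP) as [P1 [P2 [HP1 HTP]]].
  destruct (expands_factor n _ _ (expands_lin _ _ _ _ (- beta)%C (expands_mul_derived _ _ Hp1) Hp))
    as [Q [HQ EQ]].
  { intros k Hk. rewrite (Hb k Hk). ring. }
  destruct (expands_taylor _ _ HQ) as [Q1 [Q2 [_ HTQ]]].
  set (c := (RtoC (INR n) - beta)%C) in *.
  assert (EPQ : forall z, unit_disk z -> Q z = (z * P1 z + c * P z)%C).
  { apply expands_unique with (2 := expands_lin _ _ _ _ c (expands_mul_derived _ _ HP1) HP).
    revert HQ. apply expands_ext; [| reflexivity].
    intro k. rewrite plus_INR, RtoC_plus. unfold c. ring. }
  assert (HPM : forall z, unit_disk z -> Cmod (P z) <= M).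
  { apply (first_order_bound P P1 P2 c M HTP).
    - unfold c. destruct beta as [x y]. simpl in *. lra.
    - intros z Hz. rewrite <- (EPQ z Hz).
      apply (schwarz_order Q Q1 Q2 n); [exact HTQ | | exact Hz].
      intros w Hw. rewrite <- Cmod_pow, <- Cmod_mult, <- (EQ w Hw).
      replace (w * p1 w + - beta * p w)%C with (w * p1 w - beta * p w)%C by ring.
      now apply Hq. }
  intros z Hz. rewrite (EP z Hz), Cmod_mult, Cmod_pow, Rmult_comm.
  apply Rmult_le_compat_r; [apply pow_le, Cmod_ge_0 | now apply HPM].
Qed.

(** Equivalent to |2 alpha - w| < |w|: w is closer to 2 alpha than to 0. *)
Lemma half_plane_inversion (alpha : R) (w : C) :
  0 < alpha < Re w ->
  w <> RtoC 0 /\ Cmod (1 / w - RtoC (1 / (2 * alpha)))%C < 1 / (2 * alpha).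
Proof.
  intros Hw.
  assert (Hw0 : w <> RtoC 0) by (intros ->; simpl in Hw; lra).
  split; [exact Hw0 |].
  assert (Ha : RtoC (2 * alpha) <> RtoC 0) by (intro E; apply RtoC_inj in E; lra).
  assert (Hwm : 0 < Cmod w) by now apply Cmod_gt_0.
  replace (1 / w - RtoC (1 / (2 * alpha)))%C
    with ((RtoC (2 * alpha) - w) / (RtoC (2 * alpha) * w))%C.
  2: { rewrite RtoC_div by lra. field. now split. }
  assert (Hlt : Cmod (RtoC (2 * alpha) - w)%C < Cmod w).
  { destruct w as [x y]. simpl in Hw. unfold Cmod. apply sqrt_lt_1_alt.
    assert (0 < alpha * (x - alpha)) by (apply Rmult_lt_0_compat; lra).
    split; [apply Rplus_le_le_0_compat; apply pow2_ge_0 | simpl; lra]. }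
  rewrite Cmod_div, Cmod_mult, Cmod_R, Rabs_pos_eq; try lra.
  2: { now apply Cmult_neq_0. }
  apply Rmult_lt_reg_r with (2 * alpha * Cmod w); [nra |].
  replace (Cmod (RtoC (2 * alpha) - w) / (2 * alpha * Cmod w) * (2 * alpha * Cmod w))
    with (Cmod (RtoC (2 * alpha) - w)) by (field; lra).
  replace (1 / (2 * alpha) * (2 * alpha * Cmod w)) with (Cmod w) by (field; lra).
  exact Hlt.
Qed.

Lemma C_derive_expansion (a : nat -> C) (f : C -> C) :
  expands a f -> expands (derived_coef a) (C_derive f).
Proof.
  intro Hf. destruct (expands_taylor a f Hf) as [f1 [f2 [Hf1 HT]]].
  revert Hf1. apply expands_ext; [reflexivity |].
  intros z Hz. symmetry. apply is_C_derive_unique. exact (taylor2_is_derive _ _ _ z HT Hz).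
Qed.

Theorem theorem3 (n : nat) (f : C -> C) (alpha : R) (beta : C)
  (hn : (1 <= n)%nat)
  (hf : class_A n f)
  (hbeta : Re beta < INR n)
  (hyp :
    (0 < alpha <= 1 / 2 /\
      forall z : C, unit_disk z ->
        Cmod (z * C_derive (C_derive f) z - beta * (C_derive f z - 1))%C
          < alpha * Cmod (RtoC (INR n) - beta)%C)
    \/
    (1 / 2 <= alpha < 1 /\
      forall z : C, unit_disk z ->
        Cmod (z * C_derive (C_derive f) z - beta * (C_derive f z - 1))%C
          < (1 - alpha) * Cmod (RtoC (INR n) - beta)%C)) :
  (forall z : C, unit_disk z ->
     C_derive f z <> RtoC 0 /\
     Cmod (1 / C_derive f z - RtoC (1 / (2 * alpha)))%C < 1 / (2 * alpha))
  /\ class_C n alpha f.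
Proof.
  (* The two cases differ only in M = alpha or M = 1 - alpha, and in both
     alpha <= 1 - M. *)
  assert (Hex : exists M, 0 < M /\ 0 < alpha /\ alpha <= 1 - M /\
    forall z : C, unit_disk z ->
      Cmod (z * C_derive (C_derive f) z - beta * (C_derive f z - 1))%C
        <= M * Cmod (RtoC (INR n) - beta)%C).
  { destruct hyp as [[Ha H] | [Ha H]]; [exists alpha | exists (1 - alpha)];
      (do 3 (split; [lra |])); intros z Hz; apply Rlt_le; now apply H. }
  destruct Hex as [M [HM [Ha [HaM HQ]]]].
  destruct (proj2 hf) as [a [_ [Ha1 [Hak Hser]]]].
  pose proof (C_derive_expansion a f (expands_pseries a f Hser)) as Hf1.
  pose proof (C_derive_expansion _ _ Hf1) as Hf2.
  assert (H0 : derived_coef a 0 = RtoC 1).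
  { unfold derived_coef. rewrite Ha1. simpl. ring. }
  assert (Hre : forall z, unit_disk z -> alpha < Re (C_derive f z)).
  { intros z Hz.
    assert (Hp : Cmod (C_derive f z - RtoC 1)%C <= M * Cmod z ^ n).
    { rewrite <- H0.
      apply (theta_operator_bound n
        (fun k => match k with 0%nat => RtoC 0 | S _ => derived_coef a k end)
        (fun z => C_derive f z - derived_coef a 0)%C (C_derive (C_derive f)) beta M);
        [exact (expands_drop_const _ _ Hf1) | exact Hf2 | | exact hbeta | | exact Hz].
      - intros [|k] Hk; [reflexivity |]. unfold derived_coef. rewrite Hak by lia. ring.
      - intros w Hw. rewrite H0. now apply HQ. }
    assert (Hzn : Cmod z ^ n < 1).
    { destruct n as [|m]; [lia |]. unfold unit_disk in Hz. generalize (Cmod_ge_0 z); intro.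
      assert (Cmod z ^ m <= 1) by (rewrite <- (pow1 m); apply pow_incr; lra).
      simpl. nra. }
    generalize (re_le_Cmod (C_derive f z - RtoC 1)%C). intro H.
    apply Rabs_le_between in H.
    destruct (C_derive f z) as [x y]. simpl in *. nra. }
  split.
  - intros z Hz. apply half_plane_inversion. split; [exact Ha | now apply Hre].
  - split; [exact hf | exact Hre].
Qed.
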